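(* Let $L_r$ and $L_p$ be the linear functionals for the type $R_I$ $q$-Lommel polynomials $r_n(x;c,q)$ and for the even-odd $q$-Lommel polynomials $p_n(x;c,q)$, respectively. Then $$L_r(x^m)=L_p(x^{2m})\qquad\text{for all }m\ge0.$$
   Context: $c,q$ are indeterminates. The type $R_I$ $q$-Lommel polynomials are defined by $r_{-1}=0$, $r_0=1$, $r_{n+1}(x;c,q)=(x-b_n)r_n(x;c,q)-x\,a_nr_{n-1}(x;c,q)$ for $n\ge0$, where $b_n=\dfrac{q^n}{1-cq^n}$ and $a_n=\dfrac{cq^{2n-1}}{(1-cq^{n-1})(1-cq^n)}$. $L_r$ is the normalized type $R_I$ orthogonality functional: the linear functional on Laurent polynomials in $x$ with $L_r(1)=1$ and $L_r(x^{-j}r_n(x;c,q))=0$ for $1\le j\le n$. It is known that its values on polynomials are determined by $L_r(r_n(x;c,q))=a_1a_2\cdots a_n$ for $n\ge0$. The even-odd $q$-Lommel polynomials are defined by $p_{-1}=0$, $p_0=1$, $p_{n+1}(x;c,q)=x\,p_n(x;c,q)-\lambda_np_{n-1}(x;c,q)$ for $n\ge0$, where $\lambda_{2n}=\dfrac{cq^{3n-1}}{(1-cq^{2n-1})(1-cq^{2n})}$ and $\lambda_{2n+1}=\dfrac{q^n}{(1-cq^{2n})(1-cq^{2n+1})}$. $L_p$ is the linear functional on polynomials with $L_p(1)=1$ and $L_p(p_mp_n)=0$ for $m\neq n$ (equivalently $L_p(1)=1$ and $L_p(p_n)=0$ for $n\ge1$). *)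

(* Defs.v *)
From HB Require Import structures.
From mathcomp Require Import all_boot all_order all_algebra.
From mathcomp Require Import finmap.
From mathcomp.multinomials Require Import monalg.

Set Implicit Arguments.
Unset Strict Implicit.
Unset Printing Implicit Defensive.

Import GRing.Theory.
Local Open Scope ring_scope.

(** The field k(c, q) of rational functions in two indeterminates; the inner
    polynomial variable is c and the outer one is q. *)
Definition ratcq (k : fieldType) : fieldType := {fraction {poly {poly k}}}.
Definition c_ind (k : fieldType) : ratcq k := tofrac ('X%:P : {poly {poly k}}).
Definition q_ind (k : fieldType) : ratcq k := tofrac ('X : {poly {poly k}}).

Section LaurentPolynomials.
Variable F : fieldType.

(** A Laurent polynomial is a finitely supported map from exponents (in Z) to
    coefficients.  Only the vector space structure comes from [malg]: its ring
    structure requires a monoid of exponents without nontrivial units. *)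
Definition laurent : lmodType F := {malg F[int]}.

Definition laurentX (e : int) : laurent := mkmalgU e 1.

(** The product x^e p(x). *)
Definition laurentXM (e : int) (p : {poly F}) : laurent :=
  \sum_(i < size p) p`_i *: laurentX (e + i%:Z).

End LaurentPolynomials.

Section QLommel.
Variables (F : fieldType) (c q : F).

Definition typeRI_b (n : nat) : F := q ^+ n / (1 - c * q ^+ n).

(** The exponents are integers, since q^(-1) occurs for n = 0. *)
Definition typeRI_a (n : nat) : F :=
  c * q ^ (2 * n%:Z - 1) / ((1 - c * q ^ (n%:Z - 1)) * (1 - c * q ^+ n)).

(** The pair (r_{n-1}, r_n). *)
Fixpoint typeRI_pair (n : nat) : {poly F} * {poly F} :=
  if n is n'.+1 then
    let: (r0, r1) := typeRI_pair n' in
    (r1, ('X - (typeRI_b n')%:P) * r1 - 'X * (typeRI_a n')%:P * r0)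
  else (0, 1).

Definition typeRI_qLommel (n : nat) : {poly F} := (typeRI_pair n).2.

Definition typeRI_functional (L : {scalar laurent F}) : Prop :=
  L (laurentX F 0) = 1 /\
  forall j n : nat, (1 <= j <= n)%N ->
    L (laurentXM (- j%:Z) (typeRI_qLommel n)) = 0.

Definition evenodd_lambda (m : nat) : F :=
  let n := m./2 in
  if odd m
  then q ^+ n / ((1 - c * q ^+ (2 * n)) * (1 - c * q ^+ (2 * n + 1)))
  else c * q ^ (3 * n%:Z - 1)
         / ((1 - c * q ^ (2 * n%:Z - 1)) * (1 - c * q ^+ (2 * n))).

(** The pair (p_{n-1}, p_n). *)
Fixpoint evenodd_pair (n : nat) : {poly F} * {poly F} :=
  if n is n'.+1 then
    let: (p0, p1) := evenodd_pair n' in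
    (p1, 'X * p1 - (evenodd_lambda n')%:P * p0)
  else (0, 1).

Definition evenodd_qLommel (n : nat) : {poly F} := (evenodd_pair n).2.

Definition evenodd_functional (L : {scalar {poly F}}) : Prop :=
  L 1 = 1 /\
  forall m n : nat, m != n -> L (evenodd_qLommel m * evenodd_qLommel n) = 0.

End QLommel.

(* Main.v *)
Require Import Defs.
From HB Require Import structures.
From mathcomp Require Import all_boot all_order all_algebra.
From mathcomp Require Import ring zify.
Set Implicit Arguments.
Unset Strict Implicit.
Unset Printing Implicit Defensive.

Import GRing.Theory.
Local Open Scope ring_scope.

(** Write r_n and p_n for the two families, d_i = 1 - c q^i, and regard both
    sides as linear functionals of a polynomial u: Lr(u) on one side,
    Lp(u(x^2)) on the other.  A functional on polynomials is determined by its
    values on the r_n ([eq_functional_typeRI]), so it suffices to compare these.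

    On the type R_I side, dividing the recurrence of r_(n+2) by x and applying
    Lr leaves Lr(r_(n+1)) = a_(n+1) Lr(r_n), hence Lr(r_n) = a_1 ... a_n.

    On the even-odd side one must show Lp(r_n(x^2)) = a_1 ... a_n.  The trick is
    to compute more, namely all the numbers

      A(n, k) = Lp(p_(2k)(x) r_n(x^2)),

    which turn out to be products:

      A(n, k) = a_1 ... a_n * prod_(i < k) rho(n, i),
      rho(n, i) = q^(i+1) (q^i - q^n) d_i
                  / ((1 - q^(i+1)) d_(n+i+1) d_(2i) d_(2i+1)).

    Up to the norm lambda_1 ... lambda_(2k) of p_(2k), these are the coefficients
    of r_n(x^2) in the basis (p_(2k)); the factor q^i - q^n makes them vanish for
    k > n.  To check the closed form by induction on n, the three-term recurrence
    of r_n is cut into two halves,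

      s_n = r_n - a_n r_(n-1),    r_(n+1) = x s_n - b_n r_n,

    and the companion numbers B(n, k) = Lp(x p_(2k+1)(x) s_n(x^2)) are carried
    along.  The recurrence of p_m applied to x p_(2k+1) gives B in terms of A
    ([functional_oddS]), and applied to x p_(2k) gives A at n+1 in terms of A and
    B at n ([functional_recS]).  B is a product too, so that each half is a
    rational function identity in c, q, q^n and q^k ([pairing_odd_S],
    [pairing_recS]).  Taking k = 0 yields the claim. *)

(** * Linearity of multiplication by a power of x *)

Section LaurentLinearity.
Variable (F : fieldType).
Implicit Types (p r : {poly F}) (e : int).

(** The sum in [laurentXM] runs up to the size of the polynomial, which is not
    additive; a uniform bound makes linearity visible. *)
Lemma laurentXM_widen N e p : (size p <= N)%N ->
  laurentXM e p = \sum_(i < N) p`_i *: laurentX F (e + i%:Z).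
Proof.
move=> leN; rewrite /laurentXM.
rewrite (big_ord_widen N (fun i => p`_i *: laurentX F (e + i%:Z)) leN).
rewrite big_mkcond /=; apply: eq_bigr => i _.
by case: ltnP => // lei; rewrite nth_default // scale0r.
Qed.

Lemma laurentXM_linear e : linear (laurentXM (F := F) e).
Proof.
move=> s p r.
have [lep ler] := (leq_maxl (size p) (size r), leq_maxr (size p) (size r)).
rewrite (laurentXM_widen e lep) (laurentXM_widen e ler).
rewrite (@laurentXM_widen (maxn (size p) (size r))); last first.
  apply: leq_trans (size_polyD _ _) _; rewrite geq_max ler andbT.
  exact: leq_trans (size_scale_leq _ _) lep.
rewrite scaler_sumr -big_split /=; apply: eq_bigr => i _.
by rewrite coefD coefZ scalerDl scalerA.
Qed.

HB.instance Definition _ e :=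
  GRing.isLinear.Build F {poly F} (laurent F) _ (laurentXM e)
    (laurentXM_linear e).

Lemma laurentXM_mulX e p : laurentXM e ('X * p) = laurentXM (e + 1) p.
Proof.
have leS : (size ('X * p)%R <= (size p).+1)%N.
  by rewrite mulrC (leq_trans (size_polyMleq _ _)) // size_polyX addn2.
rewrite (laurentXM_widen e leS) big_ord_recl coefXM scale0r add0r.
apply: eq_bigr => i _; rewrite coefXM /=.
by congr (_ *: laurentX F _); rewrite /bump /=; lia.
Qed.

Lemma laurentXM_1 e : laurentXM e (1 : {poly F}) = laurentX F e.
Proof. by rewrite /laurentXM size_poly1 big_ord1 coef1 scale1r addr0. Qed.

End LaurentLinearity.

(** * Recurrences, and the values of the type R_I functional *)

Section Recurrences.
Variables (F : fieldType) (c q : F).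

Local Notation r := (typeRI_qLommel c q).
Local Notation p := (evenodd_qLommel c q).
Local Notation a := (typeRI_a c q).
Local Notation b := (typeRI_b c q).
Local Notation lam := (evenodd_lambda c q).
Local Notation d n := (1 - c * q ^+ n).

Lemma typeRI_pairE n : (typeRI_pair c q n.+1).1 = r n.
Proof. by rewrite /typeRI_qLommel /=; case: (typeRI_pair c q n). Qed.

Lemma evenodd_pairE n : (evenodd_pair c q n.+1).1 = p n.
Proof. by rewrite /evenodd_qLommel /=; case: (evenodd_pair c q n). Qed.

Lemma typeRI_qLommel1 : r 1 = 'X - (b 0)%:P.
Proof. by rewrite /typeRI_qLommel /= mulr0 subr0 mulr1. Qed.

Lemma typeRI_qLommelSS n :
  r n.+2 = ('X - (b n.+1)%:P) * r n.+1 - 'X * (a n.+1)%:P * r n.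
Proof.
rewrite -(typeRI_pairE n) /typeRI_qLommel [typeRI_pair c q n.+2]/=.
by rewrite -/(typeRI_pair c q n.+1) [typeRI_pair c q n.+1]surjective_pairing.
Qed.

Lemma evenodd_qLommel1 : p 1 = 'X.
Proof. by rewrite /evenodd_qLommel /= mulr0 subr0 mulr1. Qed.

Lemma evenodd_qLommelSS n : p n.+2 = 'X * p n.+1 - (lam n.+1)%:P * p n.
Proof.
rewrite -(evenodd_pairE n) /evenodd_qLommel [evenodd_pair c q n.+2]/=.
by rewrite -/(evenodd_pair c q n.+1) [evenodd_pair c q n.+1]surjective_pairing.
Qed.

Lemma typeRI_aS n : a n.+1 = c * (q ^+ n) ^+ 2 * q / (d n * d n.+1).
Proof.
rewrite /typeRI_a.
have -> : 2 * (n.+1)%:Z - 1 = (n * 2).+1%:Z :> int by lia.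
have -> : (n.+1)%:Z - 1 = n%:Z :> int by lia.
by rewrite -!exprnP exprSr exprM mulrA.
Qed.

Lemma evenodd_lambda_odd k : lam k.*2.+1 = q ^+ k / (d k.*2 * d k.*2.+1).
Proof. by rewrite /evenodd_lambda /= odd_double uphalf_double mul2n addn1. Qed.

Lemma evenodd_lambda_even k :
  lam k.+1.*2 = c * (q ^+ k) ^+ 3 * q ^+ 2 / (d k.*2.+1 * d k.+1.*2).
Proof.
rewrite /evenodd_lambda odd_double doubleK mul2n.
have -> : 3 * (k.+1)%:Z - 1 = (k * 3 + 2)%:Z :> int by lia.
have -> : 2 * (k.+1)%:Z - 1 = k.*2.+1%:Z :> int by lia.
by rewrite -!exprnP exprD exprM mulrA.
Qed.

(** The recurrence expresses x r_n through r_(n+1), r_n and x r_(n-1), so that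
    agreement on all x^m r_n propagates to x^(m+1) r_n by induction on n; the
    case n = 0 covers all monomials. *)
Lemma eq_functional_typeRI (f g : {scalar {poly F}}) :
  (forall n, f (r n) = g (r n)) -> f =1 g.
Proof.
move=> fg_r.
suff fgX m n : f ('X^m * r n) = g ('X^m * r n).
  move=> u; rewrite -[u]coefK poly_def !linear_sum; apply: eq_bigr => i _.
  by rewrite !linearZ /= -['X^i]mulr1 -[1]/(r 0) fgX.
elim: m n => [|m IHm] n; first by rewrite mul1r fg_r.
elim/ltn_ind: n => -[|[|n]] IHn.
- have -> : 'X^(m.+1) * r 0 = 'X^m * r 1 + b 0 *: ('X^m * r 0).
    by rewrite typeRI_qLommel1 -[r 0]/1 -mul_polyC exprSr; ring.
  by rewrite !linearD !linearZ /= !IHm.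
- have -> : 'X^(m.+1) * r 1 = 'X^m * r 2 + b 1 *: ('X^m * r 1)
                            + a 1 *: ('X^(m.+1) * r 0).
    by rewrite (typeRI_qLommelSS 0) -!mul_polyC exprSr; ring.
  by rewrite !linearD !linearZ /= !IHm IHn.
have -> : 'X^(m.+1) * r n.+2 = 'X^m * r n.+3 + b n.+2 *: ('X^m * r n.+2)
                          + a n.+2 *: ('X^(m.+1) * r n.+1).
  by rewrite (typeRI_qLommelSS n.+1) -!mul_polyC exprSr; ring.
by rewrite !linearD !linearZ /= !IHm IHn.
Qed.

(** Orthogonality kills x^(-1) r_(n+2) and x^(-1) r_(n+1), so x^(-1) times the
    recurrence of r_(n+2) compares r_(n+1) with r_n. *)
Lemma typeRI_functional_qLommel (L : {scalar laurent F}) n :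
  typeRI_functional c q L ->
  L (laurentXM 0 (r n)) = \prod_(i < n) a i.+1.
Proof.
case=> L1 Lr0; elim: n => [|n IHn].
  by rewrite big_ord0 laurentXM_1.
rewrite big_ord_recr /= -IHn mulrC; apply/eqP; rewrite -subr_eq0 -(Lr0 1 n.+2)//.
have -> : r n.+2 = 'X * r n.+1 - b n.+1 *: r n.+1 - a n.+1 *: ('X * r n).
  by rewrite typeRI_qLommelSS -!mul_polyC; ring.
rewrite !linearB !linearZ /= !laurentXM_mulX (Lr0 1 n.+1) //=.
by rewrite mulr0 subr0 subrr.
Qed.

End Recurrences.

(** * The closed form and its two half-step recurrences *)

Section Pairing.
Variables (F : fieldType) (c q : F).

Local Notation a := (typeRI_a c q).
Local Notation b := (typeRI_b c q).
Local Notation lam := (evenodd_lambda c q).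
Local Notation d n := (1 - c * q ^+ n).

Hypothesis q_neq0 : q != 0.
Hypothesis subr1_q_neq0 : forall n, 1 - q ^+ n.+1 != 0.
Hypothesis subr1_cq_neq0 : forall n, d n != 0.

Definition pairing_ratio n k : F :=
  q ^+ k.+1 * (q ^+ k - q ^+ n) * d k
  / ((1 - q ^+ k.+1) * d (n + k).+1 * d k.*2 * d k.*2.+1).

(** The value of Lp(p_(2k)(x) r_n(x^2)), see [functional_pairing]. *)
Definition pairing n k : F :=
  (\prod_(i < n) a i.+1) * \prod_(i < k) pairing_ratio n i.

(** The value of Lp(x p_(2k+1)(x) s_n(x^2)), see the proof of
    [functional_pairing]. *)
Definition pairing_odd n k : F :=
  pairing n k * (q ^+ n * d k / (d k.*2 * d n * d (n + k).+1)).

Lemma pairing0 n : pairing n 0 = \prod_(i < n) a i.+1.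
Proof. by rewrite /pairing big_ord0 mulr1. Qed.

Lemma pairingS n k : pairing n k.+1 = pairing n k * pairing_ratio n k.
Proof. by rewrite /pairing big_ord_recr mulrA. Qed.

Lemma pairing_0S k : pairing 0 k.+1 = 0.
Proof.
by rewrite /pairing big_ord_recl /pairing_ratio subrr mulr0 !mul0r mulr0.
Qed.

(* Brings every power of q to a monomial in q, q ^+ n and q ^+ k. *)
Let expqE := (addSn, addnS, doubleS, exprS, exprD, expr0, =^~ addnn).

(** Lowering n: telescoping the ratio of the factors rho(n, i) and
    rho(n + 1, i).  The factor q^k - q^(n+1) stays on the right, so that the
    identity also covers k > n, where both sides vanish. *)
Lemma pairing_lower n k :
  a n.+1 * pairing n k =
  pairing n.+1 k * ((q ^+ k - q ^+ n.+1) * d (n + k).+1)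
  / (q ^+ k * (1 - q ^+ n.+1) * d n.+1).
Proof.
elim: k => [|k IHk].
  rewrite !pairing0 big_ord_recr /= addn0 expr0.
  have := subr1_q_neq0 n; have := subr1_cq_neq0 n.+1.
  move: (q ^+ n.+1) (a n.+1) (\prod_(i < n) _) => u x y *.
  by field; apply/andP; split.
rewrite !pairingS mulrA IHk /pairing_ratio.
have := subr1_q_neq0 n; have := subr1_q_neq0 k.
have := subr1_cq_neq0 n.+1; have := subr1_cq_neq0 (n + k).+1.
have := subr1_cq_neq0 (n + k).+2.
have := subr1_cq_neq0 k.*2; have := subr1_cq_neq0 k.*2.+1.
have := expf_neq0 k q_neq0; rewrite !expqE.
move: (q ^+ n) (q ^+ k) (pairing n.+1 k) => u v H *.
by field; rewrite ?q_neq0; do ?[apply/andP; split].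
Qed.

(** After dividing by A(n + 1, k), with u = q^(n+1) and v = q^k, this reduces to
    (v - u)(1 - cqv) + (1 - v)(1 - cquv) = (1 - u)(1 - cqv^2). *)
Lemma pairing_odd_S n k :
  pairing n.+1 k.+1 - a n.+1 * pairing n k.+1
  + lam k.*2.+1 * (pairing n.+1 k - a n.+1 * pairing n k)
  = pairing_odd n.+1 k.
Proof.
rewrite /pairing_odd !pairing_lower !pairingS evenodd_lambda_odd /pairing_ratio.
have := subr1_q_neq0 n; have := subr1_q_neq0 k.
have := subr1_cq_neq0 n.+1; have := subr1_cq_neq0 (n + k).+1.
have := subr1_cq_neq0 (n + k).+2.
have := subr1_cq_neq0 k.*2; have := subr1_cq_neq0 k.*2.+1.
have := expf_neq0 k q_neq0; rewrite !expqE.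
move: (q ^+ n) (q ^+ k) (pairing n.+1 k) => u v H *.
by field; rewrite ?q_neq0; do ?[apply/andP; split].
Qed.

Lemma pairing_rec0 n : pairing n.+1 0 = pairing_odd n 0 - b n * pairing n 0.
Proof.
rewrite /pairing_odd !pairing0 big_ord_recr /= typeRI_aS /typeRI_b addn0.
have := subr1_cq_neq0 n; have := subr1_cq_neq0 n.+1; have := subr1_cq_neq0 0.
rewrite !(expqE, mulr1).
move: (q ^+ n) (\prod_(i < n) _) => u H *.
by field; rewrite ?q_neq0; do ?[apply/andP; split].
Qed.

Lemma pairing_recS n k :
  pairing n.+1 k.+1 =
  pairing_odd n k.+1 + lam k.+1.*2 * pairing_odd n k - b n * pairing n k.+1.
Proof.
(* [pairing_lower] cannot be solved for pairing n.+1 k when k = n.+1, but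
   pairing n.+1 k.+1 contains the factor q ^+ k - q ^+ n.+1 that makes it
   solvable. *)
have aux : pairing n.+1 k * (q ^+ k - q ^+ n.+1) =
    a n.+1 * pairing n k * (q ^+ k * (1 - q ^+ n.+1) * d n.+1) / d (n + k).+1.
  rewrite pairing_lower.
  have := subr1_q_neq0 n; have := expf_neq0 k q_neq0.
  have := subr1_cq_neq0 n.+1; have := subr1_cq_neq0 (n + k).+1.
  move: (q ^+ n.+1) (q ^+ k) (q ^+ (n + k).+1) => u v w *.
  by field; do ?[apply/andP; split].
have -> : pairing n.+1 k.+1 = (pairing n.+1 k * (q ^+ k - q ^+ n.+1)) *
    (q ^+ k.+1 * d k / ((1 - q ^+ k.+1) * d (n + k).+2 * d k.*2 * d k.*2.+1)).
  by rewrite pairingS /pairing_ratio addSn; move: (_^-1) => z; ring.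
rewrite aux /pairing_odd pairingS /pairing_ratio typeRI_aS /typeRI_b.
rewrite evenodd_lambda_even.
have := subr1_q_neq0 n; have := subr1_q_neq0 k.
have := subr1_cq_neq0 n; have := subr1_cq_neq0 n.+1.
have := subr1_cq_neq0 (n + k).+1; have := subr1_cq_neq0 (n + k).+2.
have := subr1_cq_neq0 k.*2; have := subr1_cq_neq0 k.*2.+1.
have := subr1_cq_neq0 k.+1.*2.
rewrite ?(addnS, addSn) !expqE.
move: (q ^+ n) (q ^+ k) (pairing n k) => u v H *.
by field; rewrite ?q_neq0; do ?[apply/andP; split].
Qed.

End Pairing.

(** * Pairing the two families under the even-odd functional *)

Section EvenOddPairing.
Variables (F : fieldType) (c q : F).

Local Notation r := (typeRI_qLommel c q).
Local Notation p := (evenodd_qLommel c q).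
Local Notation a := (typeRI_a c q).
Local Notation b := (typeRI_b c q).
Local Notation lam := (evenodd_lambda c q).
Local Notation d n := (1 - c * q ^+ n).

Hypothesis q_neq0 : q != 0.
Hypothesis subr1_q_neq0 : forall n, 1 - q ^+ n.+1 != 0.
Hypothesis subr1_cq_neq0 : forall n, d n != 0.

Variable L : {scalar {poly F}}.
Hypothesis L_orth : evenodd_functional c q L.

Lemma evenodd_functional_qLommelS n : L (p n.+1) = 0.
Proof. by have [_ /(_ n.+1 0%N isT)] := L_orth; rewrite mulr1. Qed.

(** Half a step of the recurrence, (r_(n+1) + b_n r_n) / x.  The first component
    of [typeRI_pair] makes it r_0 for n = 0. *)
Definition typeRI_half n : {poly F} := r n - a n *: (typeRI_pair c q n).1.

Lemma typeRI_qLommelS n : r n.+1 = 'X * typeRI_half n - b n *: r n.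
Proof.
rewrite /typeRI_half; case: n => [|n].
  by rewrite typeRI_qLommel1 /= scaler0 subr0 -mul_polyC -[r 0]/1 !mulr1.
by rewrite typeRI_pairE typeRI_qLommelSS -!mul_polyC; ring.
Qed.

Lemma evenodd_qLommel_mulX_even k :
  'X * p k.*2.+1 = p k.+1.*2 + lam k.*2.+1 *: p k.*2.
Proof. by rewrite doubleS evenodd_qLommelSS -mul_polyC; ring. Qed.

Lemma evenodd_qLommel_mulX_odd k :
  'X * p k.+1.*2 = p k.+1.*2.+1 + lam k.+1.*2 *: p k.*2.+1.
Proof. by rewrite (evenodd_qLommelSS _ _ k.*2.+1) -mul_polyC; ring. Qed.

Let A n k := L (p k.*2 * (r n \Po 'X^2)).
Let B n k := L ('X * p k.*2.+1 * (typeRI_half n \Po 'X^2)).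

Lemma functional_rec0 n : A n.+1 0 = B n 0 - b n * A n 0.
Proof.
rewrite /A /B typeRI_qLommelS double0 evenodd_qLommel1 -[p 0]/1 !mul1r -expr2.
rewrite comp_polyB comp_polyM comp_polyX comp_polyZ.
by move: (typeRI_half n \Po _) (r n \Po _) => s t; rewrite linearB linearZ.
Qed.

Lemma functional_recS n k :
  A n.+1 k.+1 = B n k.+1 + lam k.+1.*2 * B n k - b n * A n k.+1.
Proof.
rewrite /A /B typeRI_qLommelS.
rewrite comp_polyB comp_polyM comp_polyX comp_polyZ.
set s := typeRI_half n \Po _; set t := r n \Po _.
have -> : p k.+1.*2 * ('X^2 * s - b n *: t) =
   'X * p k.+1.*2.+1 * s + lam k.+1.*2 *: ('X * p k.*2.+1 * s)
   - b n *: (p k.+1.*2 * t).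
  have := evenodd_qLommel_mulX_odd k; rewrite -!mul_polyC => eqX.
  have -> : p k.+1.*2 * ('X^2 * s - (b n)%:P * t) =
    'X * ('X * p k.+1.*2) * s - (b n)%:P * (p k.+1.*2 * t) by ring.
  by rewrite eqX; ring.
by rewrite linearB linearD !linearZ.
Qed.

Lemma functional_odd0 k : B 0 k = A 0 k.+1 + lam k.*2.+1 * A 0 k.
Proof.
rewrite /A /B /typeRI_half [(typeRI_pair _ _ 0).1]/= scaler0 subr0 -[r 0]/1.
by rewrite -[1]/1%:P comp_polyC !mulr1 evenodd_qLommel_mulX_even linearD linearZ.
Qed.

Lemma functional_oddS n k :
  B n.+1 k = A n.+1 k.+1 - a n.+1 * A n k.+1
             + lam k.*2.+1 * (A n.+1 k - a n.+1 * A n k).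
Proof.
rewrite /A /B /typeRI_half typeRI_pairE comp_polyB comp_polyZ.
rewrite evenodd_qLommel_mulX_even.
set s := r n.+1 \Po _; set t := r n \Po _.
have -> : (p k.+1.*2 + lam k.*2.+1 *: p k.*2) * (s - a n.+1 *: t) =
  p k.+1.*2 * s - a n.+1 *: (p k.+1.*2 * t)
  + lam k.*2.+1 *: (p k.*2 * s - a n.+1 *: (p k.*2 * t)).
  by rewrite -!mul_polyC; ring.
rewrite linearD [L (lam _ *: _)]linearZ !linearB.
by rewrite [L (a _ *: (p k.+1.*2 * t))]linearZ [L (a _ *: _)]linearZ.
Qed.

(** The closed form is proved together with that of B: B at n follows from A at
    n and n - 1, and A at n + 1 from A and B at n.  For n = 0 both reduce to
    Lp(p_m) = 0 for m > 0. *)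
Lemma functional_pairing n k : A n k = pairing c q n k.
Proof.
have A0 j : A 0 j = pairing c q 0 j.
  rewrite /A -[r 0]/(1%:P) comp_polyC mulr1; case: j => [|j].
    by rewrite pairing0 big_ord0 -[p _]/1; case: L_orth.
  by rewrite pairing_0S doubleS evenodd_functional_qLommelS.
suff [] : (forall j, A n j = pairing c q n j) /\
          (forall j, B n j = pairing_odd c q n j) by [].
elim: n => [|n [IHA IHB]].
  split=> // j; rewrite functional_odd0 !A0 pairing_0S add0r /pairing_odd.
  case: j => [|j]; last by rewrite pairing_0S mulr0 mul0r.
  rewrite evenodd_lambda_odd mulrC; congr (_ * _).
  have := subr1_cq_neq0 0; have := subr1_cq_neq0 1.
  rewrite expr0 mulr1 mul1r add0n => *.
  by field; apply/andP.
have IHAS j : A n.+1 j = pairing c q n.+1 j.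
  case: j => [|j].
    by rewrite functional_rec0 IHA IHB pairing_rec0.
  by rewrite functional_recS !IHA !IHB pairing_recS.
split=> // j.
by rewrite functional_oddS !IHAS !IHA pairing_odd_S.
Qed.

Lemma evenodd_functional_typeRI n :
  L (r n \Po 'X^2) = \prod_(i < n) a i.+1.
Proof. by rewrite -pairing0 -functional_pairing /A mul1r. Qed.

End EvenOddPairing.

(** * The denominators in the field of rational functions *)

Section Indeterminates.
Variable k : fieldType.

(** Nonvanishing is tested by specializing q to x and c to y. *)
Lemma ratcq_neq0 (u : {poly {poly k}}) x y : u.[x].[y] != 0 -> tofrac u != 0.
Proof. by rewrite tofrac_eq0; apply: contra_neq => ->; rewrite !horner0. Qed.

Lemma q_ind_neq0 : q_ind k != 0.
Proof. by apply: (@ratcq_neq0 _ 1 0); rewrite hornerX hornerC oner_neq0. Qed.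

Lemma subr1_q_ind_neq0 n : 1 - q_ind k ^+ n.+1 != 0.
Proof.
rewrite -tofracXn -tofrac1 -tofracB; apply: (@ratcq_neq0 _ 0 0).
by rewrite !hornerE expr0n /= subr0 ?hornerE oner_neq0.
Qed.

Lemma subr1_cq_ind_neq0 n : 1 - c_ind k * q_ind k ^+ n != 0.
Proof.
rewrite -tofracXn -tofracM -tofrac1 -tofracB; apply: (@ratcq_neq0 _ 1 0).
by rewrite !(hornerE, expr1n, subr0) oner_neq0.
Qed.

End Indeterminates.

(** * Equality of the moments *)

Theorem theorem4p14 (k : fieldType)
    (Lr : {scalar laurent (ratcq k)}) (Lp : {scalar {poly ratcq k}}) :
  typeRI_functional (c_ind k) (q_ind k) Lr ->
  evenodd_functional (c_ind k) (q_ind k) Lp ->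
  forall m : nat, Lr (laurentX (ratcq k) m%:Z) = Lp 'X^(2 * m).
Proof.
move=> Lr_orth Lp_orth m.
have laurentXM_Xn (e : int) : laurentXM e ('X^m) = laurentX (ratcq k) (e + m%:Z).
  elim: m e => [|m IHm] e; first by rewrite laurentXM_1 addr0.
  by rewrite exprS laurentXM_mulX IHm -addrA.
have := @eq_functional_typeRI _ (c_ind k) (q_ind k)
  (Lr \o laurentXM 0) (Lp \o comp_poly 'X^2).
move=> /(_ _ 'X^m) /=; rewrite laurentXM_Xn add0r comp_Xn_poly exprM; apply.
move=> n; rewrite (typeRI_functional_qLommel _ Lr_orth).
by rewrite evenodd_functional_typeRI //;
  [exact: q_ind_neq0 | exact: subr1_q_ind_neq0 | exact: subr1_cq_ind_neq0].
Qed.
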